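(* Let $N\ge 1$ be an integer. If the vector $(m_0,m_{1/2},\dots,m_{N/2})\in\mathbb{R}^{N+1}$ belongs to the interior of the $N$-th fractional moment space, then there exists a unique number density function $n^{ME}$ on $[0,1]$ maximizing the Shannon entropy $$H[n]=-\int_0^1 n(S)\ln(n(S))\,dS$$ under the constraints $$m_{k/2}=\int_0^1 S^{k/2}n(S)\,dS,\qquad k=0,\dots,N.$$ Moreover, it has the form $$n^{ME}(S)=\exp\Big(-\lambda_0-\sum_{i=1}^{N}\lambda_i S^{i/2}\Big)$$ for some real coefficients $\lambda_0,\dots,\lambda_N$.
   Context: A number density function (NDF) on $[0,1]$ is a nonnegative integrable function $n$ on $[0,1]$; NDFs are identified when equal almost everywhere, and $0\ln 0=0$ (the entropy $H[n]$ takes values in $[-\infty,+\infty)$). The $N$-th normalized fractional moment space is the set of vectors $(c_0(\mu),c_{1/2}(\mu),\dots,c_{N/2}(\mu))$ with $c_{k/2}(\mu)=\int_0^1 x^{k/2}\,d\mu(x)$, where $\mu$ ranges over all probability measures on $[0,1]$ (so $c_0=1$). The $N$-th fractional moment space is the set of vectors $(m_0,m_{1/2},\dots,m_{N/2})\in\mathbb{R}^{N+1}$ with $m_0>0$ such that $(m_0,\dots,m_{N/2})/m_0$ belongs to the $N$-th normalized fractional moment space. ''Interior'' means interior as a subset of $\mathbb{R}^{N+1}$ (equivalently: $m_0>0$ and the normalized vector lies in the interior of the normalized space relative to the hyperplane $c_0=1$). *)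

(* Defs.v *)
From HB Require Import structures.
From mathcomp Require Import all_boot all_order all_algebra.
From mathcomp Require Import all_classical all_reals all_analysis.

Set Implicit Arguments.
Unset Strict Implicit.
Unset Printing Implicit Defensive.

Import Order.TTheory GRing.Theory Num.Theory.
Import numFieldNormedType.Exports.

Local Open Scope classical_set_scope.
Local Open Scope ring_scope.

(* A number density function on [0,1] is represented by a function on R, of
   which only the values on [0,1] matter. *)
Definition is_ndf (R : realType) (n : R -> R) : Prop :=
  (forall x : R, 0 <= x <= 1 -> 0 <= n x) /\
  (@lebesgue_measure R).-integrable `[0%R, 1%R] (EFin \o n).

Definition ndf_eq (R : realType) (n1 n2 : R -> R) : Prop :=
  n1 = n2 %[ae @lebesgue_measure R in `[0%R, 1%R]%classic].

(* Since ln 0 = 0 in the library, the integrand vanishes where n does. As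
   t * ln t >= - 1/e for t >= 0, the integral is well defined in ]-oo, +oo]
   for every number density function, even when it is not finite. *)
Definition entropy (R : realType) (n : R -> R) : \bar R :=
  (- \int[@lebesgue_measure R]_(x in `[0%R, 1%R]) (n x * ln (n x))%:E)%E.

(* Column k of a vector holds the moment of order k/2; note that
   0 `^ 0 = 1 and 0 `^ a = 0 for a != 0. *)
Definition normalized_fractional_moment_space (R : realType) (N : nat) :
    set 'rV[R]_N.+1 :=
  [set c : 'rV[R]_N.+1 | exists mu : probability (measurableTypeR R) R,
     mu `[0%R, 1%R]%classic = 1%E /\
     forall k : 'I_N.+1,
       (\int[mu]_(x in `[0%R, 1%R]) (x `^ (k%:R / 2))%:E)%E = (c 0 k)%:E].

Definition fractional_moment_space (R : realType) (N : nat) :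
    set 'rV[R]_N.+1 :=
  [set m : 'rV[R]_N.+1 | 0 < m 0 0 /\
     normalized_fractional_moment_space ((m 0 0)^-1 *: m)].

Definition has_fractional_moments (R : realType) (N : nat) (m : 'rV[R]_N.+1)
    (n : R -> R) : Prop :=
  forall k : 'I_N.+1,
    (\int[@lebesgue_measure R]_(x in `[0%R, 1%R]) (x `^ (k%:R / 2) * n x)%:E)%E
    = (m 0 k)%:E.

Definition is_entropy_maximizer (R : realType) (N : nat) (m : 'rV[R]_N.+1)
    (n : R -> R) : Prop :=
  [/\ is_ndf n, has_fractional_moments m n &
      forall n' : R -> R, is_ndf n' -> has_fractional_moments m n' ->
        (entropy n' <= entropy n)%E].

(* Main.v *)
(** The maximizer is obtained by Lagrange duality.  Write p_l(x) = sum_k l_k x^(k/2)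
and minimize the dual function  D(l) = int_0^1 exp(-p_l) + <l, m>.  Moving m by
-e sgn(l) inside the moment space gives  <l, m> >= e |l|_1 + B min p_l;  when the
minimum of p_l is very negative, Hoelder continuity of p_l keeps p_l below half
of it on an interval of length independent of l, so that the exponential
integral compensates.  Hence D is coercive and, being continuous, attains its
minimum at some c.  Stationarity at c says that exp(-p_c) has the moments m.
Gibbs' inequality  t ln t >= t ln s + t - s  with s = exp(-p_c(x)) then yields
maximality, and its equality case uniqueness. *)

Require Import Defs.
From HB Require Import structures.
From mathcomp Require Import all_boot all_order all_algebra.
From mathcomp Require Import all_classical all_reals all_analysis.
From mathcomp Require Import measurable_realfun ring lra.

Set Implicit Arguments.
Unset Strict Implicit.
Unset Printing Implicit Defensive.

Import Order.TTheory GRing.Theory Num.Theory.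
Import numFieldNormedType.Exports.

Local Open Scope classical_set_scope.
Local Open Scope ring_scope.

(** * Elementary inequalities for exp, ln, powers and square roots *)

(** This is [ln (1 + x) <= x] at [x = s / t - 1], multiplied by [t]; at [t = 0] it reduces to
    [- s <= 0]. *)
Lemma gibbs_le (R : realType) (t s : R) : 0 <= t -> 0 < s ->
  t * ln s + (t - s) <= t * ln t.
Proof.
rewrite le_eqVlt => /predU1P[<- s0|t0 s0]; first by rewrite !mul0r; lra.
have := @le_ln1Dx R (s / t - 1).
rewrite (addrC 1) subrK ln_div ?posrE// ltrBrDr addrC subrr divr_gt0// => /(_ isT).
rewrite -(ler_pM2l t0) !mulrBr mulr1 [t * (s / t)]mulrC divfK ?gt_eqF//; lra.
Qed.

(** Strictness comes from [1 + u < expR u] for [u = ln (s / t) != 0]. *)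
Lemma gibbs_eq (R : realType) (t s : R) : 0 <= t -> 0 < s ->
  t * ln t = t * ln s + (t - s) -> t = s.
Proof.
rewrite le_eqVlt => /predU1P[<- s0|t0 s0]; first by rewrite !mul0r; lra.
move=> e; apply/eqP/contraT => ts.
have u0 : ln (s / t) != 0.
  rewrite ln_eq0 ?divr_gt0//; apply: contra ts => /eqP st1.
  by rewrite -[s](divfK (lt0r_neq0 t0)) st1 mul1r.
have := expR_gt1Dx u0; rewrite lnK ?posrE ?divr_gt0// ln_div ?posrE//.
rewrite -(ltr_pM2l t0) !mulrDr mulr1 [t * (s / t)]mulrC divfK ?gt_eqF//; lra.
Qed.

(** Since [1 + u <= expR u], it suffices that [(1 + u) * (1 - u + 2 * u ^+ 2) = 1 + u ^+ 2 * (1 + 2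
    * u)] is at least 1. This second-order bound replaces differentiation under the integral
    sign. *)
Lemma expRN_le_quad (R : realType) (u : R) : `|u| <= 2^-1 ->
  expR (- u) <= 1 - u + 2 * u ^+ 2.
Proof.
rewrite ler_norml => /andP[u1 u2].
have := expR_ge1Dx u; rewrite -[expR u]invrK -expRN => h.
have u0 : 0 < 1 + u by lra.
rewrite -[_ <= _](ler_pM2l u0).
apply: (@le_trans _ _ 1); last by nra.
rewrite -ler_pdivlMr ?expR_gt0// div1r//.
Qed.

Lemma dist_expR_le (R : realType) (K a b : R) : a <= K -> b <= K ->
  `|expR a - expR b| <= expR K * `|a - b|.
Proof.
wlog ab : a b / a <= b => [h aK bK|aK bK].
  have [/h|/ltW/h] := leP a b; first exact.
  by rewrite distrC [X in _ * X]distrC; apply.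
rewrite distrC [X in _ * X]distrC !ger0_norm ?subr_ge0 ?ler_expR//.
have := expR_ge1Dx (a - b); rewrite -(ler_pM2l (expR_gt0 b)) -expRD.
rewrite [b + _]addrC subrK => h.
apply: (@le_trans _ _ (expR b * (b - a))); first by lra.
by rewrite ler_wpM2r ?subr_ge0// ler_expR.
Qed.

Lemma dist_expr_le (R : realFieldType) (k : nat) (s t : R) :
  0 <= s <= 1 -> 0 <= t <= 1 -> `|s ^+ k - t ^+ k| <= k%:R * `|s - t|.
Proof.
move=> s01 t01; elim: k => [|k IH]; first by rewrite !expr0 subrr normr0 mul0r.
have -> : s ^+ k.+1 - t ^+ k.+1 = s * (s ^+ k - t ^+ k) + (s - t) * t ^+ k.
  by rewrite !exprS; ring.
apply: le_trans (ler_normD _ _) _; rewrite !normrM -natr1 mulrDl mul1r.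
case/andP: s01 => s0 s1; case/andP: t01 => t0 t1.
rewrite lerD//; first by rewrite (le_trans _ IH)// ler_piMl// ger0_norm.
by rewrite ler_piMr// ger0_norm ?exprn_ge0// exprn_ile1.
Qed.

Lemma dist_sqrt_le (R : rcfType) (x y : R) : 0 <= x -> 0 <= y ->
  `|Num.sqrt x - Num.sqrt y| <= Num.sqrt `|x - y|.
Proof.
move=> x0 y0; rewrite -(sqrtr_sqr (Num.sqrt x - _)); apply: ler_wsqrtr.
rewrite -[in leRHS](sqr_sqrtr x0) -[in leRHS](sqr_sqrtr y0) subr_sqr normrM.
rewrite -real_normK ?num_real// expr2 ler_wpM2l// [leRHS]ger0_norm ?addr_ge0//.
have := sqrtr_ge0 x; have := sqrtr_ge0 y.
by rewrite ler_norml; lra.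
Qed.

(** * Integrals of functions with an integrable minorant, and of linear combinations *)

(** Only [g] is integrable: the lemma serves for [f = n * ln n], whose integral may be infinite.
    Positive and negative parts are therefore compared separately. *)
Lemma le_integral_of_integrable_minorant d (T : measurableType d)
    (R : realType) (mu : {measure set T -> \bar R}) (D : set T) (f g : T -> R) :
    measurable D -> measurable_fun D f -> mu.-integrable D (EFin \o g) ->
    (forall x, D x -> g x <= f x) ->
  (\int[mu]_(x in D) (g x)%:E <= \int[mu]_(x in D) (f x)%:E)%E.
Proof.
move=> mD mf ig gf; rewrite integralE [leRHS]integralE.
have mg := measurable_int mu ig.
have /measurable_EFinP mf' := mf.
have gf' x : x \in D -> ((EFin \o g) x <= (EFin \o f) x)%E.
  by move=> /set_mem/gf; rewrite lee_fin.
apply: leeB.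
- apply: ge0_le_integral => //; [exact: measurable_funepos..|].
  by move=> x /mem_set; exact: funepos_le.
- apply: ge0_le_integral => //; [exact: measurable_funeneg..|].
  by move=> x /mem_set; exact: funeneg_le.
Qed.

Lemma ae_eq_of_integrable_minorant d (T : measurableType d)
    (R : realType) (mu : {measure set T -> \bar R}) (D : set T) (f g : T -> R) :
    measurable D -> measurable_fun D f -> mu.-integrable D (EFin \o g) ->
    (forall x, D x -> g x <= f x) ->
    (\int[mu]_(x in D) (f x)%:E = \int[mu]_(x in D) (g x)%:E)%E ->
  f = g %[ae mu in D].
Proof.
move=> mD mf ig gf fg.
have /measurable_EFinP mf' := mf.
(* Equality with the finite integral of [g] forces [f] to be integrable, so the integrals may be
   subtracted. *)
have if_ : mu.-integrable D (EFin \o f).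
  apply/integrableP; split => //; rewrite integral_fin_num_abs// fg.
  exact: (integrable_fin_num mD ig).
have : (\int[mu]_(x in D) `|((EFin \o f) \- (EFin \o g)) x| = 0)%E.
  rewrite (eq_integral ((EFin \o f) \- (EFin \o g))%E).
    by rewrite integralB//= fg subee// (integrable_fin_num mD ig).
  by move=> x /set_mem Dx; rewrite gee0_abs//= -EFinB lee_fin subr_ge0 gf.
have mB : measurable_fun D (((EFin \o f) \- (EFin \o g))%E : T -> \bar R).
  by apply: emeasurable_funB => //; exact: measurable_int ig.
move/(ae_eq_integral_abs mu mD mB); apply: filterS => x /[apply] /=.
by rewrite -EFinD => -[/eqP]; rewrite subr_eq0 => /eqP.
Qed.

Lemma integrable_lincomb d (T : measurableType d) (R : realType)
    (mu : {measure set T -> \bar R}) (D : set T) (I : Type) (s : seq I)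
    (l : I -> R) (f : I -> T -> R) :
    measurable D -> (forall i, mu.-integrable D (EFin \o f i)) ->
  mu.-integrable D (EFin \o (fun x => \sum_(i <- s) l i * f i x)).
Proof.
move=> mD fi.
have -> : EFin \o (fun x => \sum_(i <- s) l i * f i x) =
    (fun x => \sum_(i <- s) (l i)%:E * (EFin \o f i) x)%E.
  by apply/funext => x /=; rewrite -sumEFin.
by apply: integrable_sum => // i _; exact: (integrableZl mD (l i) (fi i)).
Qed.

Lemma integral_lincomb d (T : measurableType d) (R : realType)
    (mu : {measure set T -> \bar R}) (D : set T) (I : Type) (s : seq I)
    (l c : I -> R) (f : I -> T -> R) :
    measurable D -> (forall i, mu.-integrable D (EFin \o f i)) ->
    (forall i, \int[mu]_(x in D) (f i x)%:E = (c i)%:E)%E ->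
  (\int[mu]_(x in D) (\sum_(i <- s) l i * f i x)%:E =
   (\sum_(i <- s) l i * c i)%:E)%E.
Proof.
move=> mD fi fc.
under eq_integral do rewrite -sumEFin.
under eq_integral do under eq_bigr do rewrite EFinM.
rewrite integral_sum//; last by move=> i; exact: (integrableZl mD (l i) (fi i)).
rewrite -sumEFin; apply: eq_bigr => i _.
by have := integralZl mD (fi i) (l i); rewrite /= fc => ->.
Qed.

(** * Fractional polynomials on the unit interval *)

Local Notation I01 := (`[0%R, 1%R]%classic).

Definition frac_poly (R : realType) (N : nat) (l : 'rV[R]_N.+1) (x : R) : R :=
  \sum_k l 0 k * x `^ (k%:R / 2).

(** The norm dual to the sup norm, whose balls are the [ball]s of row vectors. *)
Definition l1norm (R : realType) (N : nat) (l : 'rV[R]_N.+1) : R :=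
  \sum_k `|l 0 k|.

Definition pairing (R : realType) (N : nat) (l m : 'rV[R]_N.+1) : R :=
  \sum_k l 0 k * m 0 k.

Lemma powR_half (R : realType) (k : nat) (x : R) : 0 <= x ->
  x `^ (k%:R / 2) = Num.sqrt x ^+ k.
Proof.
by move=> x0; rewrite mulrC powRrM powR12_sqrt// powR_mulrn ?sqrtr_ge0.
Qed.

Lemma sqrtr_itv01 (R : rcfType) (x : R) : 0 <= x <= 1 -> 0 <= Num.sqrt x <= 1.
Proof.
by case/andP=> x0 x1; rewrite sqrtr_ge0 -[leRHS]sqrtr1 ler_wsqrtr.
Qed.

Lemma powR_half_itv01 (R : realType) (k : nat) (x : R) : 0 <= x <= 1 ->
  0 <= x `^ (k%:R / 2) <= 1.
Proof.
move=> x01; rewrite powR_half; last by case/andP : x01.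
by have /andP[s0 s1] := sqrtr_itv01 x01; rewrite exprn_ge0// exprn_ile1.
Qed.

Lemma l1norm_ge0 (R : realType) (N : nat) (l : 'rV[R]_N.+1) : 0 <= l1norm l.
Proof. exact: sumr_ge0. Qed.

Lemma frac_poly_bound (R : realType) (N : nat) (l : 'rV[R]_N.+1) (x : R) :
  0 <= x <= 1 -> `|frac_poly l x| <= l1norm l.
Proof.
move=> x01; apply: le_trans (ler_norm_sum _ _ _) _; apply: ler_sum => k _.
have /andP[q0 q1] := powR_half_itv01 k x01.
by rewrite normrM (ger0_norm q0) ler_piMr.
Qed.

Lemma frac_polyB (R : realType) (N : nat) (l l' : 'rV[R]_N.+1) (x : R) :
  frac_poly (l - l') x = frac_poly l x - frac_poly l' x.
Proof.
by rewrite /frac_poly -sumrB; apply: eq_bigr => k _; rewrite !mxE mulrBl.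
Qed.

Lemma measurable_frac_poly (R : realType) (N : nat) (l : 'rV[R]_N.+1) (D : set R) :
  measurable_fun D (frac_poly l).
Proof.
apply: measurable_sum => k; apply: measurable_funM => //.
by apply: measurable_funTS; exact: measurable_powR.
Qed.

(** [frac_poly l] is a polynomial of degree at most [N] in the square root of [x]; powers are
    Lipschitz on [0,1] and the square root is Hoelder of exponent 1/2. *)
Lemma frac_poly_holder (R : realType) (N : nat) (l : 'rV[R]_N.+1) (x y : R) :
  0 <= x <= 1 -> 0 <= y <= 1 ->
  `|frac_poly l x - frac_poly l y| <= N%:R * l1norm l * Num.sqrt `|x - y|.
Proof.
move=> x01 y01; have /andP[x0 _] := x01; have /andP[y0 _] := y01.
rewrite /frac_poly -sumrB mulrAC mulr_sumr.
apply: le_trans (ler_norm_sum _ _ _) _; apply: ler_sum => k _.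
rewrite -mulrBr normrM mulrC ler_wpM2r// !powR_half//.
apply: le_trans (dist_expr_le _ (sqrtr_itv01 x01) (sqrtr_itv01 y01)) _.
by apply: ler_pM => //; [rewrite ler_nat -ltnS|exact: dist_sqrt_le].
Qed.

Lemma frac_poly_min (R : realType) (N : nat) (l : 'rV[R]_N.+1) :
  exists2 c : R, 0 <= c <= 1 &
    forall x, 0 <= x <= 1 -> frac_poly l c <= frac_poly l x.
Proof.
(* [p] agrees with [frac_poly l] on [0,1] and is visibly continuous on the whole line. *)
pose p (x : R) := \sum_k l 0 k * Num.sqrt x ^+ k.
have pE x : 0 <= x <= 1 -> frac_poly l x = p x.
  by case/andP=> x0 _; apply: eq_bigr => k _; rewrite powR_half.
have cp : continuous p.
  apply: continuous_big => [|k _]; first exact: add_continuous.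
  move=> x; apply: cvgM; first exact: cvg_cst.
  apply: (@continuous_comp _ _ _ (@Num.sqrt R) (fun y => y ^+ k)).
    exact: sqrt_continuous.
  exact: exprn_continuous.
have [c c01 cmin] := @EVT_min R p 0 1 ler01 (continuous_subspaceT cp).
exists c => // x x01; rewrite !pE//; exact: cmin.
Qed.

(** * Bounded integrands on [0,1] and the dual function *)

Lemma integrable_bounded01 (R : realType)
    (nu : {measure set (measurableTypeR R) -> \bar R}) (f : R -> R) (M : R) :
    (nu I01 < +oo)%E -> measurable_fun (I01 : set R) f ->
    (forall x, 0 <= x <= 1 -> `|f x| <= M) ->
  nu.-integrable I01 (EFin \o f).
Proof.
move=> fin mf fM; apply: measurable_bounded_integrable => //.
exists M; split; first exact: num_real.
move=> K MK x /=; rewrite in_itv/= => x01.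
exact: le_trans (fM _ x01) (ltW MK).
Qed.

Lemma lebesgue_measure_segment (R : realType) (a b : R) : a <= b ->
  @lebesgue_measure R (`[a, b]%classic : set R) = (b - a)%:E.
Proof.
rewrite lebesgue_measure_itv/= lte_fin le_eqVlt => /predU1P[->|->//].
by rewrite ltxx subrr.
Qed.

Lemma integrable01 (R : realType) (f : R -> R) (M : R) :
    measurable_fun (I01 : set R) f ->
    (forall x, 0 <= x <= 1 -> `|f x| <= M) ->
  (@lebesgue_measure R).-integrable I01 (EFin \o f).
Proof.
apply: integrable_bounded01.
by rewrite [X in (X < _)%E]lebesgue_measure_segment ?ltry.
Qed.

Definition exp_integral (R : realType) (N : nat) (l : 'rV[R]_N.+1) : R :=
  \int[@lebesgue_measure R]_(x in I01) expR (- frac_poly l x).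

Definition dual (R : realType) (N : nat) (m l : 'rV[R]_N.+1) : R :=
  exp_integral l + pairing l m.

Lemma measurable_exp_frac_poly (R : realType) (N : nat) (l : 'rV[R]_N.+1)
  (D : set R) : measurable_fun D (fun x => expR (- frac_poly l x)).
Proof.
apply: measurableT_comp => //; apply: measurableT_comp => //.
exact: measurable_frac_poly.
Qed.

Lemma integrable_exp_frac_poly (R : realType) (N : nat) (l : 'rV[R]_N.+1) :
  (@lebesgue_measure R).-integrable I01 (EFin \o (fun x => expR (- frac_poly l x))).
Proof.
apply: (@integrable01 _ _ (expR (l1norm l))).
  exact: measurable_exp_frac_poly.
move=> x x01; rewrite ger0_norm ?expR_ge0// ler_expR.
by apply: le_trans (frac_poly_bound l x01); rewrite -normrN ler_norm.
Qed.

(** * Coercivity of the dual function *)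

(** Integrate [a <= frac_poly l] against the probability measure that represents [m] divided by its
    mass [m 0 0]. *)
Lemma pairing_ge_of_moment (R : realType) (N : nat) (l m : 'rV[R]_N.+1) (a : R) :
    fractional_moment_space m ->
    (forall x, 0 <= x <= 1 -> a <= frac_poly l x) ->
  m 0 0 * a <= pairing l m.
Proof.
move=> [m0 [nu [nu1 num]]] al.
have fin : (nu I01 < +oo)%E by rewrite nu1 ltry.
have mI : measurable (I01 : set (measurableTypeR R)) by exact: measurable_itv.
have iq k : nu.-integrable I01 (EFin \o (fun x : R => x `^ (k%:R / 2))).
  apply: (@integrable_bounded01 _ _ _ 1) => //.
    by apply: measurable_funTS; exact: measurable_powR.
  by move=> x /(powR_half_itv01 k)/andP[q0 q1]; rewrite ger0_norm.
have := @integral_lincomb _ _ _ nu I01 'I_N.+1 (index_enum _) (l 0)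
  (((m 0 0)^-1 *: m) 0) (fun k x => x `^ (k%:R / 2)) mI (fun k => iq k) num.
have il := @integrable_lincomb _ _ _ nu I01 'I_N.+1 (index_enum _) (l 0)
  (fun k x => x `^ (k%:R / 2)) mI (fun k => iq k).
have ia : nu.-integrable I01 (EFin \o cst a).
  by apply: (@integrable_bounded01 _ _ _ `|a|).
move=> e; have : (a%:E <= \int[nu]_(x in I01) (frac_poly l x)%:E)%E.
  rewrite -[leLHS]mule1 -nu1 -integral_cst//; apply: le_integral => //.
  by move=> x; rewrite inE/= in_itv/= lee_fin => /al.
rewrite [X in (_ <= X)%E -> _]e lee_fin => h.
rewrite mulrC -ler_pdivlMr//; apply: le_trans h _.
rewrite /pairing mulr_suml; apply: ler_sum => k _.
by rewrite mxE mulrA mulrAC -mulrA.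
Qed.

Lemma pairing_ge_of_interior (R : realType) (N : nat) (m : 'rV[R]_N.+1) :
    interior (@fractional_moment_space R N) m ->
  exists e B : R, [/\ 0 < e, 0 < B & forall (l : 'rV[R]_N.+1) (a : R), a <= 0 ->
    (forall x, 0 <= x <= 1 -> a <= frac_poly l x) ->
    e * l1norm l + B * a <= pairing l m].
Proof.
move=> /nbhs_ballP[d /= d0 dm]; exists (d / 2), (`|m 0 0| + d / 2).
split; [by lra|by have := normr_ge0 (m 0 0); lra|move=> l a a0 al].
(* The shift has sup norm at most [d / 2 < d], so [m'] is still a moment vector, and it lowers the
   pairing with [l] by exactly [d / 2 * l1norm l]. *)
pose m' : 'rV[R]_N.+1 := \row_k (m 0 k - d / 2 * Num.sg (l 0 k)).
have sg1 (x : R) : `|Num.sg x| <= 1.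
  by rewrite normr_sg; case: (x != 0); rewrite ?ler01 ?lexx.
have /dm m'm : ball m d m'.
  split => // i j; rewrite mxE !ord1 /ball/= opprB addrC subrK.
  rewrite normrM ger0_norm ?divr_ge0 ?ltW//.
  by have := sg1 (l 0 j); have := normr_ge0 (Num.sg (l 0 j)); nra.
have := pairing_ge_of_moment m'm al.
have -> : pairing l m' = pairing l m - d / 2 * l1norm l.
  rewrite /pairing /l1norm mulr_sumr -sumrB; apply: eq_bigr => k _.
  by rewrite mxE normrEsg; ring.
rewrite mxE; have := sg1 (l 0 0); rewrite ler_norml.
have := ler_norm (m 0 0).
set s := Num.sg _; set M := `|m 0 0|; set L := l1norm l; move: (m 0 0) (pairing l m).
move=> m0 p m0M /andP[s1 s2] h.
have : 0 <= d / 2 * (1 + s) by rewrite mulr_ge0; lra.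
(* The mass of [m'] is at most [B = M + d / 2]; as [a <= 0], replacing it by [B] weakens the bound
   and makes it uniform in [l]. *)
move=> ds; have : 0 <= - a * (M + d / 2 - (m0 - d / 2 * s)) by rewrite mulr_ge0; lra.
lra.
Qed.

(** On an interval of length [r ^+ 2] containing [c], the Hoelder bound keeps [frac_poly l] below
    [frac_poly l c + N%:R * l1norm l * r]. *)
Lemma exp_integral_ge (R : realType) (N : nat) (l : 'rV[R]_N.+1) (c r : R) :
    0 <= c <= 1 -> 0 <= r <= 2^-1 ->
  r ^+ 2 * expR (- frac_poly l c - N%:R * l1norm l * r) <= exp_integral l.
Proof.
move=> c01 /andP[r0 r1]; set E := expR _.
have r2 : r ^+ 2 <= 2^-1 by rewrite expr2; nra.
have r20 : 0 <= r ^+ 2 by rewrite exprn_ge0.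
(* Since [r ^+ 2 <= 2^-1], the interval fits in [0,1] to the right of [c] if [c <= 2^-1], and to its
   left otherwise. *)
have [b [b0 b1 cb]] : exists b : R,
    [/\ 0 <= b, b + r ^+ 2 <= 1 & b <= c <= b + r ^+ 2].
  case/andP: c01 => c0 c1; have [c2|c2] := leP c 2^-1.
    by exists c; split; [|lra|apply/andP; split; lra].
  by exists (c - r ^+ 2); split; [lra|lra|apply/andP; split; lra].
pose J := `[b, b + r ^+ 2]%classic : set R.
have mJ : measurable (J : set (measurableTypeR R)) by exact: measurable_itv.
have JI : J `<=` I01 by apply: subset_itv; rewrite bnd_simp.
rewrite -lee_fin [leRHS]fineK; last first.
  exact: (integrable_fin_num _ (integrable_exp_frac_poly l)).
apply: (@le_trans _ _ (\int[@lebesgue_measure R]_(x in J) E%:E)%E).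
  rewrite integral_cst//= [X in (_ <= _ * X)%E]lebesgue_measure_segment ?lerDl//.
  by rewrite addrAC subrr add0r -EFinM mulrC.
apply: (@le_trans _ _
    (\int[@lebesgue_measure R]_(x in J) (expR (- frac_poly l x))%:E)%E).
  apply: ge0_le_integral => //.
  - by move=> x _; rewrite lee_fin expR_ge0.
  - by apply/measurable_EFinP; exact: measurable_exp_frac_poly.
  - move=> x Jx; have x01 : 0 <= x <= 1 by have := JI _ Jx; rewrite /= in_itv.
    rewrite lee_fin ler_expR.
    have := frac_poly_holder l x01 c01.
    have : Num.sqrt `|x - c| <= r.
      rewrite -[leRHS]ger0_norm// -(sqrtr_sqr r) ler_wsqrtr// ler_norml.
      by move: Jx cb; rewrite /J/= in_itv/=; lra.
    have := l1norm_ge0 l; rewrite ler_norml.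
    have : 0 <= N%:R :> R by [].
    move: (Num.sqrt _) => s N0 L0 sr /andP[_ h].
    have : N%:R * l1norm l * s <= N%:R * l1norm l * r.
      by rewrite ler_wpM2l// mulr_ge0.
    lra.
apply: ge0_subset_integral => //.
by apply/measurable_EFinP; exact: measurable_exp_frac_poly.
Qed.

Lemma dual_coercive (R : realType) (N : nat) (m : 'rV[R]_N.+1) :
    interior (@fractional_moment_space R N) m ->
  exists k C : R, 0 < k /\ forall l, k * l1norm l - C <= dual m l.
Proof.
move=> /pairing_ge_of_interior[e [B [e0 B0 hp]]].
(* On the relevant range [B * - min p > e * l1norm l / 2], this radius makes
   the oscillation of [p] allowed by [exp_integral_ge] at most [- min p / 2]. *)
pose r := Num.min 2^-1 (e / (4 * B * N.+1%:R)).
have N1 : 0 < N.+1%:R :> R by rewrite ltr0n.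
have r0 : 0 < r by rewrite lt_min invr_gt0 ltr0n/= divr_gt0// !mulr_gt0.
have r1 : r <= 2^-1 by rewrite ge_min lexx.
have rN : r * N%:R * (4 * B) <= e.
  have : r <= e / (4 * B * N.+1%:R) by rewrite ge_min lexx orbT.
  rewrite ler_pdivlMr ?mulr_gt0// -natr1; nra.
exists (e / 2), (4 * B ^+ 2 / r ^+ 2); split; [lra|move=> l].
have C0 : 0 <= 4 * B ^+ 2 / r ^+ 2.
  by rewrite divr_ge0 ?mulr_ge0 ?exprn_ge0 ?ltW.
have [c c01 cmin] := frac_poly_min l.
have L0 := l1norm_ge0 l; rewrite /dual.
have E0 : 0 <= exp_integral l by apply: Rintegral_ge0 => x _; exact: expR_ge0.
pose a := Num.min (frac_poly l c) 0.
have := hp l a; rewrite ge_min lexx orbT => /(_ isT) {}hp.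
have {hp} : e * l1norm l + B * a <= pairing l m.
  by apply: hp => x /cmin; apply: le_trans; rewrite ge_min lexx.
have eL : 0 <= e * l1norm l by rewrite mulr_ge0// ltW.
(* If [B * a] costs at most half of [e * l1norm l], the pairing alone suffices. Otherwise [a] is
   very negative and the exponential integral must compensate. *)
have [Ba|Ba] := leP (- (e * l1norm l) / 2) (B * a); first by lra.
have a0 : a < 0 by rewrite -(pmulr_rlt0 _ B0); lra.
have ac : frac_poly l c = a.
  by move: a0; rewrite /a minElt; case: ifP; rewrite ?ltxx.
have NLr : N%:R * l1norm l * r <= - a / 2.
  rewrite -(@ler_pM2l _ (4 * B)) ?mulr_gt0//.
  have : r * N%:R * (4 * B) * l1norm l <= e * l1norm l by rewrite ler_wpM2r.
  nra.
have r01 : 0 <= r <= 2^-1 by rewrite ltW.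
have := exp_integral_ge l c01 r01; rewrite ac => hE.
(* Growth quadratic in [a] is enough: [expR (- a / 2)] is the square of
   [expR (- a / 4) >= 1 - a / 4]. *)
have : r ^+ 2 * (a ^+ 2 / 16) <= exp_integral l.
  apply: le_trans hE; apply: ler_wpM2l; first by rewrite exprn_ge0// ltW.
  apply: (@le_trans _ _ (expR (- a / 2))); last by rewrite ler_expR; lra.
  have -> : - a / 2 = - a / 4 + - a / 4 by lra.
  rewrite expRD; have := expR_ge1Dx (- a / 4); nra.
(* Completing the square absorbs [B * a] at the price of the constant [4 * B ^+ 2 / r ^+ 2]. *)
have : 0 <= (r * a / 4 + 2 * B / r) ^+ 2 by rewrite sqr_ge0.
have -> : (r * a / 4 + 2 * B / r) ^+ 2 =
  r ^+ 2 * (a ^+ 2 / 16) + B * a + 4 * B ^+ 2 / r ^+ 2 by field; lra.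
lra.
Qed.

(** * Continuity of the dual function and existence of a minimizer *)

Lemma dist_exp_integral_le (R : realType) (N : nat) (K : R) (l l' : 'rV[R]_N.+1) :
  l1norm l <= K -> l1norm l' <= K ->
  `|exp_integral l - exp_integral l'| <= expR K * l1norm (l - l').
Proof.
move=> lK lK'.
have mI : measurable (I01 : set (measurableTypeR R)) by exact: measurable_itv.
have i1 := integrable_exp_frac_poly l; have i2 := integrable_exp_frac_poly l'.
have dB x : 0 <= x <= 1 ->
    `|expR (- frac_poly l x) - expR (- frac_poly l' x)|
    <= expR K * l1norm (l - l').
  move=> x01.
  have NK (u : 'rV[R]_N.+1) : l1norm u <= K -> - frac_poly u x <= K.
    move=> uK; apply: le_trans uK; apply: le_trans (frac_poly_bound u x01).
    by rewrite -normrN ler_norm.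
  apply: le_trans (dist_expR_le (NK _ lK) (NK _ lK')) _.
  rewrite ler_wpM2l ?expR_ge0//; apply: le_trans (frac_poly_bound _ x01).
  by rewrite frac_polyB opprK addrC distrC.
have mB : measurable_fun (I01 : set R)
    (fun x => expR (- frac_poly l x) - expR (- frac_poly l' x)).
  by apply: measurable_funB; exact: measurable_exp_frac_poly.
rewrite /exp_integral -RintegralB//.
apply: le_trans (le_normr_Rintegral _ _) _ => //; first exact: integrable01 dB.
apply: (@le_trans _ _
    (\int[@lebesgue_measure R]_(x in I01) (cst (expR K * l1norm (l - l')) x))).
  apply: le_Rintegral => //.
    apply: (@integrable01 _ _ (expR K * l1norm (l - l'))).
      by apply: measurableT_comp.
    by move=> x x01; rewrite /= normr_id dB.
  by apply: (@integrable01 _ _ `|expR K * l1norm (l - l')|).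
rewrite (Rintegral_cst _ mI).
by rewrite [X in _ * fine X]lebesgue_measure_segment//= subr0 mulr1.
Qed.

Lemma dist_pairing_le (R : realType) (N : nat) (m l l' : 'rV[R]_N.+1) :
  `|pairing l m - pairing l' m| <= l1norm m * l1norm (l - l').
Proof.
rewrite /pairing -sumrB /l1norm [_ * (\sum_k _)]mulr_sumr.
apply: le_trans (ler_norm_sum _ _ _) _; apply: ler_sum => k _.
rewrite !mxE -mulrBl normrM mulrC ler_wpM2r//.
by rewrite (bigD1 k)//= lerDl sumr_ge0.
Qed.

Lemma continuous_dual (R : realType) (N : nat) (m : 'rV[R]_N.+1) :
  continuous (dual m).
Proof.
move=> l; apply/(@cvgrPdist_le _ _ _ _ (nbhs_filter l)) => e e0.
(* [K] bounds [l1norm] on the unit sup-norm ball around [l], and [c] is a Lipschitz constant there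
   for the sup norm; the factor [N.+1%:R] compares the two norms. *)
pose K := l1norm l + N.+1%:R; pose c := (expR K + l1norm m + 1) * N.+1%:R.
have c0 : 0 < c.
  rewrite mulr_gt0 ?ltr0n//; have := expR_gt0 K; have := l1norm_ge0 m; lra.
apply/nbhs_ballP; exists (Num.min 1 (e / c)) => /=.
  by rewrite lt_min ltr01 divr_gt0.
move=> l' [_ ll'].
have dl k : `|l 0 k - l' 0 k| <= Num.min 1 (e / c).
  by have := ll' 0 k; rewrite /ball/= => /ltW.
have l1B : l1norm (l - l') <= N.+1%:R * Num.min 1 (e / c).
  have -> : N.+1%:R * Num.min 1 (e / c) = \sum_(k < N.+1) Num.min 1 (e / c).
    by rewrite sumr_const card_ord mulr_natl.
  by apply: ler_sum => k _; rewrite !mxE.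
have l'K : l1norm l' <= K.
  have -> : K = \sum_(k < N.+1) (`|l 0 k| + 1).
    by rewrite big_split/= sumr_const card_ord.
  apply: ler_sum => k _; have : `|l 0 k - l' 0 k| <= 1.
    by apply: le_trans (dl k) _; rewrite ge_min lexx.
  have := ler_normB (l 0 k) (l 0 k - l' 0 k).
  by rewrite opprB addrC subrK; lra.
have lK : l1norm l <= K by rewrite lerDl.
rewrite /dual opprD addrACA; apply: le_trans (ler_normD _ _) _.
apply: (@le_trans _ _ ((expR K + l1norm m) * l1norm (l - l'))).
  by rewrite mulrDl lerD ?dist_exp_integral_le ?dist_pairing_le.
have h : N.+1%:R * (e / c) * (expR K + l1norm m + 1) = e.
  by rewrite mulrAC [_ * (_ + 1)]mulrC -/c mulrC divfK// gt_eqF.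
have h' : l1norm (l - l') <= N.+1%:R * (e / c).
  by apply: le_trans l1B _; rewrite ler_wpM2l// ge_min lexx orbT.
have := expR_gt0 K; have := l1norm_ge0 m; have := l1norm_ge0 (l - l'); nra.
Qed.

Lemma dual_has_minimizer (R : realType) (N : nat) (m : 'rV[R]_N.+1) :
    interior (@fractional_moment_space R N) m ->
  exists c, forall l, dual m c <= dual m l.
Proof.
move=> /dual_coercive[k [C [k0 hC]]].
have l10 : l1norm (0 : 'rV[R]_N.+1) = 0.
  by rewrite /l1norm big1// => i _; rewrite mxE normr0.
(* By coercivity [dual m l] exceeds [dual m 0] once [l1norm l > r], hence outside the compact box
   [A]; a minimum over [A] is thus global. *)
pose r := (dual m 0 + C) / k.
have r0 : 0 <= r.
  by rewrite divr_ge0 ?(ltW k0)//; have := hC 0; rewrite l10; lra.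
pose A := [set l : 'rV[R]_N.+1 | forall i, `[- r, r]%classic (l 0 i)].
have A0 : A 0 by move=> i; rewrite mxE /= in_itv/=; lra.
have cA : compact A := @rV_compact R N.+1 (fun=> `[- r, r]%classic)
  (fun=> @segment_compact R (- r) r).
have [c cA' cmin] := @EVT_min_rV R _ (dual m) A (ex_intro _ _ A0) cA
  (continuous_subspaceT (@continuous_dual _ _ m)).
exists c => l; have [lA|lA] := pselect (A l); first by apply: cmin; rewrite inE.
apply: (@le_trans _ _ (dual m 0)); first by apply: cmin; rewrite inE.
have /existsNP[i li] := lA.
have : r < `|l 0 i|.
  by rewrite ltNge; apply/negP => h; apply: li; rewrite /= in_itv/= -ler_norml.
have : `|l 0 i| <= l1norm l by rewrite /l1norm (bigD1 i)//= lerDl sumr_ge0.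
move=> h1 h2; have := lt_le_trans h2 h1; rewrite ltr_pdivrMr// => h.
have := hC l; lra.
Qed.

(** * Stationarity at the minimizer *)

Lemma eq0_of_quad_ge0 (R : realFieldType) (D E : R) : 0 <= E ->
  (forall t, `|t| <= 2^-1 -> 0 <= t * D + t ^+ 2 * E) -> D = 0.
Proof.
move=> E0 h; apply/eqP/contraT => D0.
have S0 : 0 < E + `|D| + 1 by have := normr_ge0 D; lra.
(* This [t] has sign opposite to [D], so the linear term is negative if [D != 0]; the denominator
   keeps [t] admissible and the quadratic term smaller. *)
have /h : `|- D / (2 * (E + `|D| + 1))| <= 2^-1.
  rewrite normrM normrN normfV (gtr0_norm (mulr_gt0 _ S0)) ?ltr0n//.
  by rewrite ler_pdivrMr ?mulr_gt0//; lra.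
have -> : - D / (2 * (E + `|D| + 1)) * D + (- D / (2 * (E + `|D| + 1))) ^+ 2 * E
   = - (D / (2 * (E + `|D| + 1))) ^+ 2 * (E + 2 * `|D| + 2).
  by field; lra.
rewrite mulNr oppr_ge0 leNgt mulr_gt0//.
  by rewrite exprn_even_gt0//= mulf_neq0// invr_neq0// mulf_neq0// gt_eqF.
by have := normr_ge0 D; lra.
Qed.

Lemma integrable_powR_half_exp (R : realType) (N : nat) (l : 'rV[R]_N.+1) (k : nat) :
  (@lebesgue_measure R).-integrable I01
    (EFin \o (fun x => x `^ (k%:R / 2) * expR (- frac_poly l x))).
Proof.
apply: (@integrable01 _ _ (expR (l1norm l))).
  apply: measurable_funM; last exact: measurable_exp_frac_poly.
  by apply: measurable_funTS; exact: measurable_powR.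
move=> x x01; have /andP[q0 q1] := powR_half_itv01 k x01.
rewrite normrM ger0_norm// ger0_norm ?expR_ge0//.
apply: (@le_trans _ _ (expR (- frac_poly l x))).
  by rewrite ler_piMl ?expR_ge0.
rewrite ler_expR; apply: le_trans (frac_poly_bound l x01).
by rewrite -normrN ler_norm.
Qed.

(** Moving [c] by [t] along coordinate [k] changes the dual function by at most [t * (m 0 k - Ik) +
    2 * t ^+ 2 * exp_integral c]. Minimality makes this nonnegative for all small [t] of either
    sign, so the linear coefficient vanishes. *)
Lemma dual_minimizer_moments (R : realType) (N : nat) (m c : 'rV[R]_N.+1) :
    (forall l, dual m c <= dual m l) ->
  has_fractional_moments m (fun x => expR (- frac_poly c x)).
Proof.
move=> cmin k; pose w x := expR (- frac_poly c x).
have mI : measurable (I01 : set (measurableTypeR R)) by exact: measurable_itv.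
have iq := integrable_powR_half_exp c k.
have iw := integrable_exp_frac_poly c.
pose Ik := \int[@lebesgue_measure R]_(x in I01) (x `^ (k%:R / 2) * w x).
suff -> : m 0 k = Ik.
  by rewrite fineK//; exact: integrable_fin_num iq.
apply/eqP; rewrite -subr_eq0; apply/eqP.
apply: (@eq0_of_quad_ge0 _ _ (2 * exp_integral c)).
  by rewrite mulr_ge0//; apply: Rintegral_ge0 => x _; exact: expR_ge0.
move=> t t2; have := cmin (c + t *: delta_mx 0 k).
have polyE x : frac_poly (c + t *: delta_mx 0 k) x
    = frac_poly c x + t * x `^ (k%:R / 2).
  rewrite /frac_poly (bigD1 k)//= [in RHS](bigD1 k)//= addrAC !mxE !eqxx.
  rewrite mulr1 mulrDl; congr (_ + _); apply: eq_bigr => i ik.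
  by rewrite !mxE (negbTE ik) andbF mulr0 addr0.
have pairE : pairing (c + t *: delta_mx 0 k) m = pairing c m + t * m 0 k.
  rewrite /pairing (bigD1 k)//= [in RHS](bigD1 k)//= addrAC !mxE !eqxx.
  rewrite mulr1 mulrDl; congr (_ + _); apply: eq_bigr => i ik.
  by rewrite !mxE (negbTE ik) andbF mulr0 addr0.
have itq : (@lebesgue_measure R).-integrable I01
    (EFin \o (fun x => t * (x `^ (k%:R / 2) * w x))).
  exact: (integrableZl mI t iq).
have ittw : (@lebesgue_measure R).-integrable I01
    (EFin \o (fun x => 2 * t ^+ 2 * w x)).
  exact: (integrableZl mI (2 * t ^+ 2) iw).
have iB : (@lebesgue_measure R).-integrable I01
    (EFin \o (fun x => w x - t * (x `^ (k%:R / 2) * w x))).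
  exact: (integrableB mI iw itq).
have : exp_integral (c + t *: delta_mx 0 k)
    <= exp_integral c - t * Ik + 2 * t ^+ 2 * exp_integral c.
  rewrite /exp_integral /Ik -!RintegralZl// -RintegralB// -RintegralD//.
  apply: le_Rintegral => //; first exact: integrable_exp_frac_poly.
    exact: (integrableD mI iB ittw).
  move=> x /=; rewrite in_itv/= => /(powR_half_itv01 k)/andP[q0 q1].
  rewrite polyE opprD expRD -/(w x).
  have tq : `|t * x `^ (k%:R / 2)| <= 2^-1.
    by rewrite normrM (ger0_norm q0); have := normr_ge0 t; nra.
  have w0 : 0 <= w x := expR_ge0 _.
  apply: le_trans (ler_wpM2l w0 (expRN_le_quad tq)) _.
  move: q0 q1; set q := _ `^ _ => q0 q1.
  have : w x * (t ^+ 2 * q ^+ 2) <= w x * t ^+ 2.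
    by rewrite ler_wpM2l// ler_piMr ?sqr_ge0// exprn_ile1.
  nra.
rewrite /dual pairE; lra.
Qed.

(** * Entropy comparison through Gibbs' inequality *)

Lemma measurable_ndf (R : realType) (n : R -> R) : is_ndf n ->
  measurable_fun (I01 : set R) n.
Proof. by case=> _ /measurable_int/measurable_EFinP. Qed.

Lemma is_ndf_exp_frac_poly (R : realType) (N : nat) (l : 'rV[R]_N.+1) :
  is_ndf (fun x => expR (- frac_poly l x)).
Proof.
by split=> [x _|]; [exact: expR_ge0|exact: integrable_exp_frac_poly].
Qed.

(* At [s = expR (- frac_poly c x)] the right-hand side of Gibbs' inequality is
   linear in the density, so its integral is determined by the moments. *)
Definition gibbs_minorant (R : realType) (N : nat) (c : 'rV[R]_N.+1)
    (n : R -> R) (x : R) : R :=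
  n x * - frac_poly c x + (n x - expR (- frac_poly c x)).

(** The product of [n] with [- frac_poly c] integrates to [- pairing c m], and the difference of the
    two densities to 0 because they share the zeroth moment. *)
Lemma gibbs_minorant_integral (R : realType) (N : nat) (m c : 'rV[R]_N.+1)
    (n : R -> R) :
    is_ndf n -> has_fractional_moments m n ->
    has_fractional_moments m (fun x => expR (- frac_poly c x)) ->
  (@lebesgue_measure R).-integrable I01 (EFin \o gibbs_minorant c n) /\
  (\int[@lebesgue_measure R]_(x in I01) (gibbs_minorant c n x)%:E
   = (- pairing c m)%:E)%E.
Proof.
move=> ndf_n nm wm; have [_ int_n] := ndf_n.
have mI : measurable (I01 : set (measurableTypeR R)) by exact: measurable_itv.
pose w x := expR (- frac_poly c x).
(* [n] may be unbounded, but the weights are bounded by 1 on [0,1]. *)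
have iqn (k : 'I_N.+1) : (@lebesgue_measure R).-integrable I01
    (EFin \o (fun x => x `^ (k%:R / 2) * n x)).
  have mq : measurable_fun (I01 : set R) (fun x : R => x `^ (k%:R / 2)).
    by apply: measurable_funTS; exact: measurable_powR.
  apply: (integrableMr mI mq _ int_n).
  exists 1; split; first exact: num_real.
  move=> K K1 x /=; rewrite in_itv/= => /(powR_half_itv01 k)/andP[q0 q1].
  by rewrite ger0_norm// (le_trans q1)// ltW.
have i0 : (@lebesgue_measure R).-integrable I01 (EFin \o w).
  exact: integrable_exp_frac_poly.
have total u : has_fractional_moments m u ->
    (\int[@lebesgue_measure R]_(x in I01) (u x)%:E = (m 0 0)%:E)%E.
  move=> /(_ 0) <-; apply: eq_integral => x _.
  by rewrite mul0r powRr0 mul1r.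
have iD : (@lebesgue_measure R).-integrable I01 (EFin \o (fun x => n x - w x)).
  exact: (integrableB mI int_n i0).
pose S x := \sum_(k < N.+1) - c 0 k * (x `^ (k%:R / 2) * n x).
have iS : (@lebesgue_measure R).-integrable I01 (EFin \o S).
  exact: integrable_lincomb.
have gE : gibbs_minorant c n = fun x => S x + (n x - w x).
  apply/funext => x; rewrite /gibbs_minorant /S /frac_poly mulrN mulr_sumr -sumrN.
  by congr (_ + _); apply: eq_bigr => k _; ring.
rewrite gE; split; first exact: (integrableD mI iS iD).
have -> : (\int[@lebesgue_measure R]_(x in I01) (S x + (n x - w x))%:E =
    \int[@lebesgue_measure R]_(x in I01) (S x)%:E +
    \int[@lebesgue_measure R]_(x in I01) (n x - w x)%:E)%E.
  exact: (integralD mI iS iD).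
have -> : (\int[@lebesgue_measure R]_(x in I01) (n x - w x)%:E = 0)%E.
  have -> : (\int[@lebesgue_measure R]_(x in I01) (n x - w x)%:E =
    \int[@lebesgue_measure R]_(x in I01) (n x)%:E -
    \int[@lebesgue_measure R]_(x in I01) (w x)%:E)%E.
    exact: (integralB mI int_n i0).
  by rewrite !total// subee.
rewrite adde0 (@integral_lincomb _ _ _ _ _ _ _ _ (m 0))//.
by congr EFin; rewrite /pairing -sumrN; apply: eq_bigr => k _; rewrite mulNr.
Qed.

Lemma entropy_exp_frac_poly (R : realType) (N : nat) (m c : 'rV[R]_N.+1) :
    has_fractional_moments m (fun x => expR (- frac_poly c x)) ->
  entropy (fun x => expR (- frac_poly c x)) = (pairing c m)%:E.
Proof.
move=> wm; have [_ h] := gibbs_minorant_integral (is_ndf_exp_frac_poly c) wm wm.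
have -> : (pairing c m)%:E = (- (- pairing c m)%:E)%E by rewrite EFinN oppeK.
rewrite -h /entropy; congr (- _)%E.
by apply: eq_integral => x _; rewrite expRK /gibbs_minorant subrr addr0.
Qed.

(** All competitors have a Gibbs minorant with the same integral [- pairing c m]. If the entropies
    agree, [n * ln n] equals its minorant almost everywhere, and [gibbs_eq] applies pointwise. *)
Lemma entropy_le_exp_frac_poly (R : realType) (N : nat) (m c : 'rV[R]_N.+1)
    (n : R -> R) :
    has_fractional_moments m (fun x => expR (- frac_poly c x)) ->
    is_ndf n -> has_fractional_moments m n ->
  (entropy n <= entropy (fun x => expR (- frac_poly c x)))%E /\
  (entropy n = entropy (fun x => expR (- frac_poly c x)) ->
   ndf_eq n (fun x => expR (- frac_poly c x))).
Proof.
move=> wm ndf_n nm; have [n0 _] := ndf_n.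
have mI : measurable (I01 : set (measurableTypeR R)) by exact: measurable_itv.
have mn := measurable_ndf ndf_n.
have mnln : measurable_fun (I01 : set R) (fun x => n x * ln (n x)).
  apply: measurable_funM => //.
  by apply: measurableT_comp => //; exact: measurable_ln.
have [ig gE] := gibbs_minorant_integral ndf_n nm wm.
have gle x : (I01 : set R) x -> gibbs_minorant c n x <= n x * ln (n x).
  rewrite /= in_itv/= => /n0 nx0.
  by have := gibbs_le nx0 (expR_gt0 (- frac_poly c x)); rewrite expRK.
rewrite (entropy_exp_frac_poly wm); split.
  rewrite /entropy leeNl -EFinN -gE.
  exact: le_integral_of_integrable_minorant.
move=> nE.
have : (\int[@lebesgue_measure R]_(x in I01) (n x * ln (n x))%:E =
    \int[@lebesgue_measure R]_(x in I01) (gibbs_minorant c n x)%:E)%E.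
  by rewrite gE EFinN -nE /entropy oppeK.
move/(ae_eq_of_integrable_minorant mI mnln ig gle).
apply: filterS => x h I01x; move: (h I01x); move: I01x.
rewrite /= in_itv/= => /n0 nx0 e; apply: (gibbs_eq nx0 (expR_gt0 _)).
by rewrite expRK.
Qed.

Theorem theorem3p1 (R : realType) (N : nat) (hN : (1 <= N)%N)
    (m : 'rV[R]_N.+1) (hm : interior (@fractional_moment_space R N) m) :
  exists nME : R -> R,
    [/\ is_entropy_maximizer m nME,
        forall n : R -> R, is_entropy_maximizer m n -> ndf_eq n nME &
        exists lambda : 'rV[R]_N.+1,
          ndf_eq nME (fun x : R =>
            expR (- lambda 0 0
                  - \sum_(i < N.+1 | i != 0) lambda 0 i * x `^ (i%:R / 2)))].
Proof.
have [c /dual_minimizer_moments wm] := dual_has_minimizer hm.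
have ndf_w := is_ndf_exp_frac_poly c.
exists (fun x => expR (- frac_poly c x)); split.
- by split=> // n ndf_n nm; have [] := entropy_le_exp_frac_poly wm ndf_n nm.
(* Another maximizer also dominates the exponential density, so both entropies coincide and the
   equality case applies. *)
- move=> n [ndf_n nm nmax]; have [le_n eq_n] := entropy_le_exp_frac_poly wm ndf_n nm.
  by apply: eq_n; apply/eqP; rewrite eq_le le_n nmax.
- exists c; apply: aeW => x _.
  by rewrite /frac_poly (bigD1 0)//= mul0r powRr0 mulr1 opprD.
Qed.
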